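(* For each of the following triples $(k,g,n)$ there exists a $k$-regular graph of girth exactly $g$ with exactly $n$ vertices (i.e. $n$ belongs to the $(k,g)$-spectrum): \begin{itemize} \item $(k,g)=(3,11)$ and $n=140$; \item $(k,g)=(3,12)$ and $n\in\{152,176,186,190,198,200\}$; \item $(k,g)=(4,7)$ and $n=81$; \item $(k,g)=(4,8)$ and $n\in\{90,112,117,123,129\}$; \item $(k,g)=(5,7)$ and $n\in\{184,188,190,192,198,200,204,208,210,212,216,220,224,228,230,232,234,236,240,244,248,250,252,256\}$. \end{itemize}
   Context: Graphs are finite and simple. A $(k,g)$-graph is a $k$-regular graph with girth exactly $g$. The $(k,g)$-spectrum is the set of all orders $n$ for which a $(k,g)$-graph with $n$ vertices exists. *)

(* Defs.v *)
From mathcomp Require Import all_boot.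

Set Implicit Arguments.
Unset Strict Implicit.
Unset Printing Implicit Defensive.

Record sgraph := SGraph {
  svertex :> finType;
  adj : rel svertex;
  adj_sym : symmetric adj;
  adj_irrefl : irreflexive adj }.

Definition regular (k : nat) (G : sgraph) : Prop :=
  forall x : G, #|[set y : G | adj x y]| = k.

(* A cycle is listed without repeating its first vertex, so its length is the
   size of the list. The bound 3 is needed because [ucycle] also accepts the
   empty list and lists [:: x; y] with x and y adjacent. *)
Definition graph_cycle (G : sgraph) (c : seq G) : Prop :=
  2 < size c /\ ucycle (@adj G) c.

(* Girth exactly g; an acyclic graph has no girth in this sense. *)
Definition has_girth (g : nat) (G : sgraph) : Prop :=
  (exists2 c : seq G, graph_cycle c & size c = g) /\
  (forall c : seq G, graph_cycle c -> g <= size c).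

Definition kg_graph (k g : nat) (G : sgraph) : Prop :=
  regular k G /\ has_girth g G.

Definition spectrum (k g n : nat) : Prop :=
  exists2 G : sgraph, kg_graph k g G & #|G| = n.

(* Main.v *)
Require Import Defs.
From mathcomp Require Import all_boot.

(** Each graph is found as a cyclic lift of a small voltage multigraph: the
    vertices are pairs [(i, x)] with [i < r] and [x] in Z/m, and a base edge
    [(i, j, a)] joins [(i, x)] to [(j, x + a)] for every [x]. Since
    [(i, x) |-> (i, x + 1)] is an automorphism, only the cycles through the [r]
    vertices [(i, 0)] matter for the girth. A cycle of length less than [g] is a
    closed non-backtracking walk, so it suffices to exclude those by exhaustive
    search and to find one simple closed walk of length [g]. *)

Set Implicit Arguments.
Unset Strict Implicit.
Unset Printing Implicit Defensive.

(** * Bounded searches for closed walks, over an arbitrary neighbour function *)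

Section GirthSearch.

Variables (T : eqType) (nbr : T -> seq T).

(* [if] rather than [&&] and [||]: call-by-value evaluation then prunes. *)
Fixpoint returns (d : nat) (prev u t : T) : bool :=
  if d is d'.+1 then
    has (fun w => if w == prev then false else
                  if w == t then true else returns d' u w t) (nbr u)
  else false.

Fixpoint closes (l : nat) (vis : seq T) (u t : T) : bool :=
  if l is l'.+1 then
    has (fun w => if w \in vis then false else closes l' (w :: vis) w t) (nbr u)
  else t \in nbr u.

Let e : rel T := fun u v => v \in nbr u.

(** Only completeness of [returns] is needed: its failure must rule out short cycles, so banning
    just the previous vertex is enough. The case of empty [p] is singled out because stepping
    straight to [t] is rejected as backtracking when [t] is [prev]. In the induction [u] becomes
    [prev], and [uniq (u :: p)] restores the hypotheses. *)
Lemma path_returns d prev u t p : path e u (rcons p t) -> uniq (u :: p) ->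
  prev \notin p -> t \notin u :: p -> (p == [::] -> prev != t) ->
  size p < d -> returns d prev u t.
Proof.
elim: p d prev u => [|w p IHp] [|d] prev u //=.
  move=> /andP[eut _] _ _ _ /(_ isT) prevNt _.
  by apply/hasP; exists t => //; rewrite eq_sym (negPf prevNt) eqxx.
move=> /andP[euw pw] /andP[uNwp wp] prevNwp tN _ lt_p_d.
apply/hasP; exists w => //.
move: prevNwp; rewrite inE negb_or eq_sym => /andP[/negPf-> prevNp].
case: eqP => // _.
apply: IHp => //.
- by move: uNwp; rewrite inE negb_or => /andP[].
- by move: tN; rewrite inE negb_or => /andP[].
- by move: tN; rewrite inE negb_or eq_sym => /andP[].
Qed.

(** The outer [has] takes the first edge of the cycle, which leaves depth [g.-2] for total lengths
    below [g]. Here [prev] and [t] are both [x], so [1 < size p] excludes the backtrack from [x] to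
    [w] and back. *)
Lemma ucycle_returns g x p :
    ucycle e (x :: p) -> 1 < size p -> (size p).+1 < g ->
  has (fun w => returns g.-2 x w x) (nbr x).
Proof.
case: p => [|w p] // /andP[/= /andP[exw pw] /andP[xNwp wp]] p_gt0 lt_p_g.
apply/hasP; exists w => //; apply: path_returns pw _ _ _ _ _ => //.
- by move: xNwp; rewrite inE negb_or => /andP[].
- by case: p p_gt0 {wp xNwp lt_p_g}.
- by case: g lt_p_g => [|[|g]].
Qed.

(** For [closes] the direction needed is soundness, to exhibit a cycle. Each chosen vertex joins
    [vis], so the avoidance clause of the induction hypothesis yields [uniq p]. *)
Lemma closesP l vis u t : closes l vis u t ->
  exists p, [/\ size p = l, path e u (rcons p t), uniq p & ~~ has (mem vis) p].
Proof.
elim: l vis u => [|l IHl] vis u /=.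
  by move=> tu; exists [::]; rewrite /= /e tu.
move=> /hasP[w uw]; case: ifPn => // wNvis /IHl[p [<- pw p_uniq pNvis]].
exists (w :: p); split => //=.
- by rewrite /e uw.
- rewrite p_uniq andbT; apply: contra pNvis => wp.
  by apply/hasP; exists w => //=; rewrite inE eqxx.
- rewrite negb_or wNvis; apply: contra pNvis => /hasP[y yp /= y_vis].
  by apply/hasP; exists y => //=; rewrite inE [y \in vis]y_vis orbT.
Qed.

End GirthSearch.

(** The search inspects vertices only through [nbr] and equality tests, so it commutes with
    injective symmetries. The domain [D] is there because translation modulo [m] is injective on
    reduced residues, not on all naturals. *)
Lemma returns_map (T : eqType) (nbr : T -> seq T) (D : {pred T}) (h : T -> T) :
    {in D &, injective h} ->
    {in D, forall u, {subset nbr u <= D}} ->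
    {in D, forall u, nbr (h u) = map h (nbr u)} ->
  forall d, {in D & &, forall prev u t,
    returns nbr d (h prev) (h u) (h t) = returns nbr d prev u t}.
Proof.
move=> h_inj nbrD nbr_h; elim=> [|d IHd] //= prev u t Dprev Du Dt.
rewrite nbr_h // has_map; apply: eq_in_has => w /(nbrD _ Du) Dw /=.
by rewrite !(inj_in_eq h_inj) // IHd.
Qed.

(** * Cyclic lifts of voltage tables: construction, regularity and girth *)

Section CyclicLift.

Variables (m : nat) (tab : seq (seq (nat * nat))).

(** Row [i] of [tab] lists the darts [(j, a)] leaving base vertex [i]. Plain pairs of naturals,
    rather than ordinals, keep the search free of proof terms during evaluation. *)
Definition lift_nbr (u : nat * nat) : seq (nat * nat) :=
  [seq (ja.1, (u.2 + ja.2) %% m) | ja <- nth [::] tab u.1].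

(** Row length and [uniq s] give regularity, the absence of [(i, 0)] gives irreflexivity, and the
    presence of every reverse dart gives symmetry. Loops of nonzero voltage are allowed. *)
Definition voltage_ok (k : nat) : bool :=
  all (fun i => let s := nth [::] tab i in
    [&& size s == k, uniq s, (i, 0) \notin s &
        all (fun ja => [&& ja.1 < size tab, ja.2 < m &
               (i, (m - ja.2) %% m) \in nth [::] tab ja.1]) s])
  (iota 0 (size tab)).

(** The depth is [g.-2] in the first search because the outer [has] already takes one step; in the
    second, [g.-1] new vertices together with the start make a cycle of length [g]. *)
Definition lift_girth_ok (g : nat) : bool :=
  all (fun i => ~~ has (fun w => returns lift_nbr g.-2 (i, 0) w (i, 0))
                       (lift_nbr (i, 0)))
      (iota 0 (size tab))
  && has (fun i => closes lift_nbr g.-1 [:: (i, 0)] (i, 0) (i, 0))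
      (iota 0 (size tab)).

Variables (k : nat) (m_gt0 : 0 < m) (tab_ok : voltage_ok k).

Let vertex : finType := ('I_(size tab) * 'I_m)%type.
Let pt (v : vertex) : nat * nat := (val v.1, val v.2).
Let inD : pred (nat * nat) := fun p => (p.1 < size tab) && (p.2 < m).

Let lift_adj : rel vertex := fun u v => pt v \in lift_nbr (pt u).

Lemma pt_inj : injective pt.
Proof. by case=> i x [j y] [/val_inj-> /val_inj->]. Qed.

Lemma pt_inD v : pt v \in inD.
Proof. by apply/andP; split; apply: ltn_ord. Qed.

Lemma inD_pt p : p \in inD -> exists v, pt v = p.
Proof.
by case: p => i x /andP[/= lti ltx]; exists (Ordinal lti, Ordinal ltx).
Qed.

Lemma voltage_row i : i < size tab -> let s := nth [::] tab i in
  [/\ size s = k, uniq s, (i, 0) \notin s &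
      forall j a, (j, a) \in s ->
        [/\ j < size tab, a < m & (i, (m - a) %% m) \in nth [::] tab j]].
Proof.
move=> lti; have /(allP tab_ok) : i \in iota 0 (size tab) by rewrite mem_iota.
move=> /= /and4P[/eqP-> -> -> /allP s_ok]; split=> // j a ja.
exact/and3P/(s_ok _ ja).
Qed.

Lemma lift_nbr_inD u : u \in inD -> {subset lift_nbr u <= inD}.
Proof.
move=> /andP[lti _] _ /mapP[[j a] ja ->].
have [_ _ _ /(_ _ _ ja)[ltj _ _]] := voltage_row lti.
by apply/andP; rewrite ltn_pmod.
Qed.

Lemma lift_adj_sym : symmetric lift_adj.
Proof.
suff half u v : lift_adj u v -> lift_adj v u.
  by move=> u v; apply/idP/idP; apply: half.
move=> /mapP[[j a] ja [v1 v2]].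
have [_ _ _ /(_ _ _ ja)[_ lta opp]] := voltage_row (ltn_ord u.1).
apply/mapP; exists (val u.1, (m - a) %% m); first by rewrite /= v1.
(* The reverse dart undoes the translation: [x + a + (m - a) = x + m], which reduces to [x]. *)
congr (_, _); rewrite /= v2 /= modnDml modnDmr -addnA subnKC ?(ltnW lta) //.
by rewrite modnDr modn_small.
Qed.

Lemma lift_adj_irrefl : irreflexive lift_adj.
Proof.
move=> u; apply/negbTE/mapP => -[[j a] ja [u1 u2]].
have [_ _ /negP i0 /(_ _ _ ja)[_ lta _]] := voltage_row (ltn_ord u.1).
(* A self-neighbour forces [j = i] and [x + a = x] modulo [m]; since [a < m], the dart would be
   [(i, 0)]. *)
apply: i0; suff <- : a = 0 by rewrite {1}[nat_of_ord u.1]u1.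
have: val u.2 + a == val u.2 + 0 %[mod m].
  by rewrite addn0 (modn_small (ltn_ord u.2)); apply/eqP/esym.
by rewrite eqn_modDl modn_small // mod0n => /eqP.
Qed.

Definition cyclic_lift : sgraph := SGraph lift_adj_sym lift_adj_irrefl.

Lemma card_cyclic_lift : #|cyclic_lift| = size tab * m.
Proof. by rewrite card_prod !card_ord. Qed.

(** Voltages in a row are below [m], so adding [x] modulo [m] keeps distinct darts distinct, and the
    degree is the length of the row. *)
Lemma cyclic_lift_regular : regular k cyclic_lift.
Proof.
move=> u; have [size_s s_uniq _ s_ok] := voltage_row (ltn_ord u.1).
rewrite -size_s -(size_map (fun ja => (ja.1, ((pt u).2 + ja.2) %% m))).
rewrite -/(lift_nbr (pt u)).
rewrite cardE -(size_map pt); apply/perm_size/uniq_perm.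
- by rewrite (map_inj_uniq pt_inj) enum_uniq.
- rewrite map_inj_in_uniq // => -[j a] [i b].
  move=> /s_ok[_ lta _] /s_ok[_ ltb _] [<- /eqP].
  by rewrite eqn_modDl !modn_small // => /eqP->.
move=> p; apply/mapP/idP => [[v]|p_nbr]; first by rewrite mem_enum inE => uv ->.
have /inD_pt[v def_p] := lift_nbr_inD (pt_inD u) p_nbr.
by exists v; rewrite // mem_enum inE /= /lift_adj def_p.
Qed.

(** This is the deck transformation of the lift given by [x] in Z/m. *)
Let shift (x : nat) (p : nat * nat) := (p.1, (p.2 + x) %% m).

Lemma lift_nbr_shift x u : lift_nbr (shift x u) = map (shift x) (lift_nbr u).
Proof.
rewrite /lift_nbr -map_comp; apply: eq_map => ja.
by rewrite /shift /= !modnDml addnAC.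
Qed.

Lemma returns_shift d x : {in inD & &, forall prev u t,
  returns lift_nbr d (shift x prev) (shift x u) (shift x t) =
  returns lift_nbr d prev u t}.
Proof.
apply: (@returns_map _ lift_nbr inD (shift x) _ _ _ d).
- move=> [i y] [j z] /andP[/= _ lty] /andP[/= _ ltz] [-> /eqP].
  by rewrite eqn_modDr !modn_small // => /eqP->.
- exact: lift_nbr_inD.
- by move=> u _; apply: lift_nbr_shift.
Qed.

Lemma cyclic_lift_girth g : 2 < g -> lift_girth_ok g -> has_girth g cyclic_lift.
Proof.
move=> g_gt2 /andP[/allP no_short /hasP[i]]; rewrite mem_iota => /= lti.
move=> /closesP[p [size_p path_p p_uniq]]; rewrite has_sym /= orbF => iNp.
split=> [|c [c_gt2 cyc]].
  have /inD_pt[v def_v] : (i, 0) \in inD by rewrite unfold_in /= lti.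
  (* The walk found consists of pairs of naturals. It lifts to genuine vertices because [inD]
     propagates along neighbours from [(i, 0)]. *)
  have [q def_q] : exists q, map pt q = p.
    have: all inD p.
      have: (i, 0) \in inD by rewrite -def_v pt_inD.
      move: path_p; rewrite rcons_path => /andP[+ _].
      elim: (p) (i, 0) => [|w s IHs] u //= /andP[uw path_s] Du.
      have Dw := lift_nbr_inD Du uw; apply/andP; split=> //.
      exact: IHs path_s Dw.
    elim: (p) => [|w s IHs] /=; first by exists [::].
    by move=> /andP[/inD_pt[a <-] /IHs[q <-]]; exists (a :: q).
  exists (v :: q).
    split.
      rewrite /= -(size_map pt) def_q size_p.
      by case: g g_gt2 {no_short size_p} => [|[]].
    apply/andP; split; last first.
      by rewrite /= -(mem_map pt_inj) -(map_inj_uniq pt_inj) def_q def_v iNp.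
    by move: path_p; rewrite -def_v -def_q -map_rcons path_map.
  by rewrite /= -(size_map pt) def_q size_p prednK // (ltn_trans _ g_gt2).
case: c c_gt2 cyc => [|x p'] //= c_gt2 /andP[cyc c_uniq].
rewrite leqNgt; apply/negP => lt_c_g.
have: ucycle (fun u v => v \in lift_nbr u) (pt x :: map pt p').
  rewrite /ucycle -[_ :: _]/(map pt (x :: p')) (map_inj_uniq pt_inj) c_uniq.
  by rewrite andbT /= -map_rcons path_map.
move=> /ucycle_returns => /(_ g); rewrite size_map => /(_ c_gt2 lt_c_g).
have Dx0 : (val x.1, 0) \in inD by rewrite unfold_in /= ltn_ord.
(* Any vertex is a translate of the vertex with second coordinate 0 in its fibre, so a short cycle
   through [x] makes the search from [(val x.1, 0)] succeed, against [no_short]. *)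
have <- : shift (val x.2) (val x.1, 0) = pt x.
  by rewrite /shift /= add0n modn_small ?ltn_ord.
have /no_short/negP nope : val x.1 \in iota 0 (size tab).
  by rewrite mem_iota ltn_ord.
rewrite lift_nbr_shift has_map => /hasP[w w_nbr] /=.
have Dw := lift_nbr_inD Dx0 w_nbr.
rewrite returns_shift // => ret_w.
by apply: nope; apply/hasP; exists w.
Qed.

End CyclicLift.

(** * From lists of base edges to membership in the spectrum *)

(* A base loop [(i, i, m / 2)] is its own reverse, so it contributes 1 to the
   degree: [undup] merges its two darts. *)
Definition voltage_table (r m : nat) (es : seq (nat * nat * nat)) :=
  let darts := es ++ [seq (e.1.2, e.1.1, (m - e.2) %% m) | e <- es] in
  mkseq (fun i => undup [seq (d.1.2, d.2) | d <- darts & d.1.1 == i]) r.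

Definition lift_ok (k g : nat) (d : nat * nat * seq (nat * nat * nat)) : bool :=
  let: (r, m, es) := d in let tab := voltage_table r m es in
  [&& 0 < m, 2 < g, voltage_ok m tab k & lift_girth_ok m tab g].

Lemma spectrum_lift k g r m es : lift_ok k g (r, m, es) -> spectrum k g (r * m).
Proof.
rewrite /lift_ok; set tab := voltage_table r m es.
move=> /and4P[m_gt0 g_gt2 tab_ok girth_ok].
exists (cyclic_lift tab_ok); last by rewrite card_cyclic_lift size_mkseq.
by split; [apply: cyclic_lift_regular | apply: cyclic_lift_girth].
Qed.

(** All the checks for one pair [k], [g] are packed into a single closed boolean, to be settled by
    evaluation; the equation on [ns] compares the claimed orders with the products [r * m]. *)
Lemma spectrum_lifts k g ds ns :
    all (lift_ok k g) ds && (ns == [seq d.1.1 * d.1.2 | d <- ds]) ->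
  forall n, n \in ns -> spectrum k g n.
Proof.
move=> /andP[/allP ds_ok /eqP->] n /mapP[[[r m] es] /ds_ok d_ok ->].
exact: spectrum_lift d_ok.
Qed.

(* Each entry is [(r, m, base edges)], for a lift of order [r * m]. *)
Definition lifts_3_11 :=
  [:: (20, 7, [:: (0, 1, 0); (0, 1, 3); (0, 2, 0); (1, 3, 0); (2, 4, 0);
    (2, 5, 0); (3, 6, 0); (3, 7, 0); (4, 7, 5); (4, 8, 0); (5, 9, 0);
    (5, 10, 0); (6, 12, 1); (6, 14, 0); (7, 11, 0); (8, 10, 1); (8, 19, 2);
    (9, 14, 2); (9, 18, 6); (10, 19, 3); (11, 12, 0); (11, 13, 0);
    (12, 13, 5); (13, 15, 0); (14, 16, 2); (15, 16, 0); (15, 17, 0);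
    (16, 18, 0); (17, 18, 6); (17, 19, 0)])].

Definition lifts_3_12 :=
  [:: (4, 38, [:: (0, 0, 17); (0, 1, 0); (1, 2, 0); (1, 3, 0); (2, 2, 3);
    (3, 3, 5)]);
    (8, 22, [:: (0, 1, 0); (0, 1, 20); (0, 2, 0); (1, 3, 0); (2, 6, 11);
    (2, 7, 0); (3, 4, 0); (3, 5, 0); (4, 6, 0); (4, 6, 5); (5, 7, 12);
    (5, 7, 15)]);
    (6, 31, [:: (0, 1, 0); (0, 4, 8); (0, 5, 0); (1, 2, 0); (1, 3, 0);
    (2, 4, 0); (2, 5, 29); (3, 4, 17); (3, 5, 10)]);
    (38, 5, [:: (0, 1, 0); (0, 2, 0); (0, 4, 0); (1, 3, 0); (1, 5, 0);
    (2, 3, 1); (2, 6, 0); (3, 7, 0); (4, 8, 0); (4, 10, 0); (5, 9, 0);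
    (5, 11, 0); (6, 12, 0); (6, 22, 0); (7, 13, 0); (7, 23, 0); (8, 9, 3);
    (8, 14, 0); (9, 15, 0); (10, 11, 2); (10, 16, 0); (11, 17, 0);
    (12, 18, 4); (12, 24, 2); (13, 19, 1); (13, 25, 3); (14, 18, 0);
    (14, 20, 0); (15, 19, 0); (15, 21, 0); (16, 24, 0); (16, 26, 0);
    (17, 25, 0); (17, 27, 0); (18, 30, 0); (19, 31, 0); (20, 21, 4);
    (20, 36, 0); (21, 37, 0); (22, 32, 0); (22, 34, 0); (23, 33, 0);
    (23, 35, 0); (24, 28, 0); (25, 29, 0); (26, 27, 4); (26, 35, 3);
    (27, 34, 2); (28, 29, 3); (28, 32, 2); (29, 33, 3); (30, 31, 1);
    (30, 32, 3); (31, 33, 2); (34, 36, 3); (35, 37, 2); (36, 37, 2)]);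
    (6, 33, [:: (0, 0, 13); (0, 1, 0); (1, 2, 0); (1, 3, 0); (2, 5, 0);
    (2, 5, 31); (3, 4, 0); (3, 4, 9); (4, 5, 1)]);
    (10, 20, [:: (0, 0, 1); (0, 1, 0); (1, 2, 0); (1, 3, 0); (2, 4, 0);
    (2, 4, 6); (3, 6, 0); (3, 7, 0); (4, 5, 0); (5, 8, 0); (5, 9, 0);
    (6, 7, 13); (6, 8, 17); (7, 9, 9); (8, 9, 1)])].

Definition lifts_4_7 :=
  [:: (3, 27, [:: (0, 0, 4); (0, 1, 0); (0, 2, 0); (1, 1, 5); (1, 2, 7);
    (2, 2, 13)])].

Definition lifts_4_8 :=
  [:: (3, 30, [:: (0, 0, 7); (0, 1, 0); (0, 2, 0); (1, 1, 3); (1, 2, 25);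
    (2, 2, 13)]);
    (4, 28, [:: (0, 0, 5); (0, 1, 0); (0, 2, 0); (1, 2, 21); (1, 2, 25);
    (1, 3, 12); (2, 3, 0); (3, 3, 1)]);
    (3, 39, [:: (0, 0, 12); (0, 1, 0); (0, 2, 0); (1, 1, 1); (1, 2, 18);
    (2, 2, 14)]);
    (3, 41, [:: (0, 1, 0); (0, 1, 13); (0, 2, 0); (0, 2, 25); (1, 2, 8);
    (1, 2, 30)]);
    (3, 43, [:: (0, 0, 12); (0, 1, 0); (0, 2, 0); (1, 1, 1); (1, 2, 16);
    (2, 2, 10)])].

Definition lifts_5_7 :=
  [:: (8, 23, [:: (0, 1, 0); (0, 1, 17); (0, 3, 3); (0, 4, 13); (0, 7, 12);
    (1, 4, 0); (1, 5, 18); (1, 7, 0); (2, 2, 11); (2, 3, 0); (2, 4, 0);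
    (2, 5, 0); (3, 5, 16); (3, 5, 19); (3, 6, 2); (4, 4, 8); (5, 6, 0);
    (6, 6, 8); (6, 7, 6); (7, 7, 2)]);
    (4, 47, [:: (0, 0, 3); (0, 1, 0); (0, 2, 0); (0, 3, 25); (1, 1, 17);
    (1, 2, 40); (1, 3, 46); (2, 2, 8); (2, 3, 0); (3, 3, 5)]);
    (5, 38, [:: (0, 0, 18); (0, 1, 0); (0, 2, 35); (0, 4, 0); (1, 1, 19);
    (1, 2, 0); (1, 3, 27); (1, 4, 9); (2, 2, 7); (2, 3, 0); (3, 3, 5);
    (3, 4, 22); (4, 4, 4)]);
    (6, 32, [:: (0, 0, 4); (0, 1, 0); (0, 2, 0); (0, 3, 0); (1, 2, 18);
    (1, 3, 29); (1, 4, 23); (1, 5, 0); (2, 2, 1); (2, 4, 0); (3, 3, 13);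
    (3, 5, 11); (4, 4, 12); (4, 5, 19); (5, 5, 9)]);
    (6, 33, [:: (0, 0, 5); (0, 1, 0); (0, 2, 0); (0, 5, 0); (1, 2, 20);
    (1, 3, 0); (1, 4, 23); (1, 5, 19); (2, 3, 25); (2, 4, 6); (2, 5, 1);
    (3, 3, 16); (3, 4, 0); (4, 4, 4); (5, 5, 8)]);
    (4, 50, [:: (0, 0, 8); (0, 1, 0); (0, 2, 0); (0, 3, 0); (1, 1, 9);
    (1, 2, 47); (1, 3, 35); (2, 2, 7); (2, 3, 48); (3, 3, 11)]);
    (4, 51, [:: (0, 0, 18); (0, 1, 0); (0, 2, 0); (0, 3, 30); (1, 1, 10);
    (1, 2, 37); (1, 3, 3); (2, 2, 8); (2, 3, 0); (3, 3, 2)]);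
    (4, 52, [:: (0, 0, 12); (0, 1, 0); (0, 2, 0); (0, 3, 0); (1, 1, 8);
    (1, 2, 27); (1, 3, 2); (2, 2, 10); (2, 3, 48); (3, 3, 9)]);
    (5, 42, [:: (0, 0, 6); (0, 1, 0); (0, 2, 0); (0, 4, 39); (1, 1, 21);
    (1, 2, 17); (1, 3, 0); (1, 4, 0); (2, 2, 9); (2, 3, 2); (3, 3, 13);
    (3, 4, 38); (4, 4, 11)]);
    (4, 53, [:: (0, 0, 19); (0, 1, 0); (0, 2, 0); (0, 3, 0); (1, 1, 10);
    (1, 2, 16); (1, 3, 13); (2, 2, 2); (2, 3, 26); (3, 3, 18)]);
    (4, 54, [:: (0, 0, 24); (0, 1, 0); (0, 2, 0); (0, 3, 0); (1, 1, 17);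
    (1, 2, 35); (1, 3, 25); (2, 2, 23); (2, 3, 28); (3, 3, 11)]);
    (4, 55, [:: (0, 0, 23); (0, 1, 0); (0, 2, 0); (0, 3, 38); (1, 1, 7);
    (1, 2, 20); (1, 3, 0); (2, 2, 18); (2, 3, 40); (3, 3, 27)]);
    (4, 56, [:: (0, 0, 20); (0, 1, 0); (0, 2, 10); (0, 3, 38); (1, 1, 11);
    (1, 2, 0); (1, 3, 0); (2, 2, 7); (2, 3, 43); (3, 3, 26)]);
    (4, 57, [:: (0, 0, 18); (0, 1, 0); (0, 2, 0); (0, 3, 27); (1, 1, 20);
    (1, 2, 24); (1, 3, 16); (2, 2, 1); (2, 3, 0); (3, 3, 5)]);
    (5, 46, [:: (0, 0, 23); (0, 1, 0); (0, 2, 9); (0, 3, 16); (0, 4, 0);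
    (1, 1, 13); (1, 3, 1); (1, 4, 24); (2, 2, 20); (2, 3, 0); (2, 4, 0);
    (3, 3, 17); (4, 4, 21)]);
    (4, 58, [:: (0, 0, 8); (0, 1, 0); (0, 2, 49); (0, 3, 0); (1, 1, 17);
    (1, 2, 4); (1, 3, 6); (2, 2, 18); (2, 3, 0); (3, 3, 5)]);
    (6, 39, [:: (0, 0, 12); (0, 1, 0); (0, 2, 0); (0, 4, 15); (1, 2, 33);
    (1, 3, 20); (1, 4, 19); (1, 5, 13); (2, 2, 16); (2, 5, 0); (3, 3, 8);
    (3, 4, 0); (3, 5, 0); (4, 4, 18); (5, 5, 17)]);
    (4, 59, [:: (0, 0, 24); (0, 1, 0); (0, 2, 43); (0, 3, 38); (1, 1, 7);
    (1, 2, 0); (1, 3, 58); (2, 2, 10); (2, 3, 0); (3, 3, 17)]);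
    (4, 60, [:: (0, 0, 1); (0, 1, 0); (0, 2, 18); (0, 3, 27); (1, 1, 11);
    (1, 2, 0); (1, 3, 46); (2, 2, 13); (2, 3, 0); (3, 3, 6)]);
    (4, 61, [:: (0, 0, 10); (0, 1, 0); (0, 2, 0); (0, 3, 15); (1, 1, 16);
    (1, 2, 28); (1, 3, 58); (2, 2, 21); (2, 3, 0); (3, 3, 22)]);
    (4, 62, [:: (0, 0, 2); (0, 1, 0); (0, 2, 0); (0, 3, 8); (1, 1, 22);
    (1, 2, 53); (1, 3, 29); (2, 2, 25); (2, 3, 0); (3, 3, 14)]);
    (5, 50, [:: (0, 0, 8); (0, 1, 0); (0, 2, 0); (0, 3, 0); (1, 1, 25);
    (1, 2, 38); (1, 3, 40); (1, 4, 0); (2, 2, 7); (2, 4, 27); (3, 3, 19);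
    (3, 4, 21); (4, 4, 24)]);
    (4, 63, [:: (0, 0, 15); (0, 1, 0); (0, 2, 61); (0, 3, 0); (1, 1, 4);
    (1, 2, 0); (1, 3, 31); (2, 2, 7); (2, 3, 12); (3, 3, 9)]);
    (4, 64, [:: (0, 0, 4); (0, 1, 0); (0, 2, 0); (0, 3, 39); (1, 1, 9);
    (1, 2, 44); (1, 3, 0); (2, 2, 17); (2, 3, 15); (3, 3, 1)])].

Theorem mainTheorem14 :
  spectrum 3 11 140 /\
  (forall n : nat, n \in [:: 152; 176; 186; 190; 198; 200] ->
     spectrum 3 12 n) /\
  spectrum 4 7 81 /\
  (forall n : nat, n \in [:: 90; 112; 117; 123; 129] -> spectrum 4 8 n) /\
  (forall n : nat,
     n \in [:: 184; 188; 190; 192; 198; 200; 204; 208; 210; 212; 216; 220; 224;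
               228; 230; 232; 234; 236; 240; 244; 248; 250; 252; 256] ->
     spectrum 5 7 n).
Proof.
split.
  (* A single order comes without a membership premise from which [ns] could be inferred, so [ns] is
     given; [vm_compute] then settles both the check and the membership of 140. *)
  by apply: (spectrum_lifts (ds := lifts_3_11) (ns := [:: 140])); vm_compute.
split; first by apply: (spectrum_lifts (ds := lifts_3_12)); vm_compute.
split.
  by apply: (spectrum_lifts (ds := lifts_4_7) (ns := [:: 81])); vm_compute.
split; first by apply: (spectrum_lifts (ds := lifts_4_8)); vm_compute.
by apply: (spectrum_lifts (ds := lifts_5_7)); vm_compute.
Qed.
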